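(* Let $t\ge 3$ and let $2\le \ell_1\le \ell_2\le\cdots\le \ell_t$ be integers. If $\ell_t<p(\ell_1,\ldots,\ell_{t-1})$, then $$p(\ell_1,\ldots,\ell_t)=\left\lfloor\frac{\ell_1+2\ell_2+\cdots+2^{t-1}\ell_t-2}{2^t-2}\right\rfloor.$$ Otherwise, i.e. if $\ell_t\ge p(\ell_1,\ldots,\ell_{t-1})$, then $p(\ell_1,\ldots,\ell_t)=p(\ell_1,\ldots,\ell_{t-1})$.
   Context: $P_m$ denotes the path with $m$ vertices. For integers $k\ge 2$ and $\ell_1,\ldots,\ell_k\ge 2$, $p(\ell_1,\ldots,\ell_k)$ denotes the least integer $n$ such that for every colouring of the edges of $K_n$ with colours $1,\ldots,k$ there is some $i\in\{1,\ldots,k\}$ and a copy of $P_{\ell_i}$ in $K_n$ none of whose edges has colour $i$. *)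

(* Defs.v *)
From mathcomp Require Import all_boot.

Set Implicit Arguments.
Unset Strict Implicit.
Unset Printing Implicit Defensive.

(* The edge {x, y} of K_n, x != y, is the two-element set [set x; y] of        *)
(* vertices. A colouring also assigns (irrelevant) values to the other sets.  *)
Definition edge_colouring (n k : nat) := {ffun {set 'I_n} -> 'I_k}.

(* A copy of P_m in K_n is given by the sequence of its m distinct vertices.  *)
Definition has_path_avoiding (n k : nat) (c : edge_colouring n k) (i : 'I_k)
    (m : nat) : bool :=
  [exists s : m.-tuple 'I_n,
     uniq s && sorted (fun x y => c [set x; y] != i) s].

(* Colours are numbered from 0, so that colour i goes with the entry of index *)
(* i of ls.                                                                   *)
Definition path_unavoidable (ls : seq nat) (n : nat) : bool :=
  [forall c : edge_colouring n (size ls),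
     [exists i : 'I_(size ls), has_path_avoiding c i (nth 0 ls i)]].

Lemma ramsey_seq (T : eqType) (e : rel T) a b (s : seq T) :
  2 ^ (a + b) <= size s ->
  exists2 r, subseq r s &
    (size r == a) && pairwise e r
    || (size r == b) && pairwise (fun x y => ~~ e x y) r.
Proof.
have [m] := ubnP (a + b); elim: m => // m IHm in a b s *.
case: a => [|a] lt_m; first by exists [::]; rewrite ?sub0seq.
case: b => [|b] in lt_m *; first by exists [::]; rewrite ?sub0seq ?orbT.
case: s => [|x s]; first by rewrite leqn0 expn_eq0.
rewrite addSn expnS mul2n -addnn => size_s.
have := count_predC (e x) s; rewrite -!size_filter => szE.
have [le1|lt1] := leqP (2 ^ (a + b.+1)) (size (filter (e x) s)).
  have [|r sub_r] := IHm a b.+1 _ _ le1; first by rewrite -ltnS.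
  case/orP=> [/andP[/eqP<- pr]|good]; last first.
    exists r; last by rewrite good orbT.
    apply: (subseq_trans sub_r).
    exact: subseq_trans (filter_subseq _ _) (subseq_cons _ _).
  exists (x :: r); first by rewrite /= eqxx (subseq_trans sub_r) ?filter_subseq.
  rewrite /= eqxx pr andbT /=; apply/orP; left; apply/allP=> y /(mem_subseq sub_r).
  by rewrite mem_filter => /andP[].
have le2 : 2 ^ (a.+1 + b) <= size (filter (predC (e x)) s).
  rewrite addSnnS -(leq_add2l (2 ^ (a + b.+1))) (leq_trans size_s) //=.
  by rewrite -szE -addSn leq_add2r.
have [|r sub_r] := IHm a.+1 b _ _ le2; first by rewrite addSnnS -ltnS.
case/orP=> [good|/andP[/eqP<- pr]].
  exists r; last by rewrite good.
  apply: (subseq_trans sub_r).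
  exact: subseq_trans (filter_subseq _ _) (subseq_cons _ _).
exists (x :: r); first by rewrite /= eqxx (subseq_trans sub_r) ?filter_subseq.
rewrite /= eqxx pr andbT /=; apply/orP; right; apply/allP=> y /(mem_subseq sub_r).
by rewrite mem_filter => /andP[].
Qed.

Lemma path_unavoidable_ex (ls : seq nat) :
  exists n, (1 < size ls) ==> path_unavoidable ls n.
Proof.
have [k_gt1|] := boolP (1 < size ls); last by exists 0.
exists (2 ^ (nth 0 ls 0 + nth 0 ls 1)); rewrite implyTb.
apply/forallP=> c.
pose i0 := Ordinal (ltnW k_gt1); pose i1 := Ordinal k_gt1.
pose e x y := c [set x; y] != i0.
have [|r sub_r] := @ramsey_seq _ e (nth 0 ls 0) (nth 0 ls 1) (enum 'I__).
  by rewrite size_enum_ord.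
have uniq_r : uniq r := subseq_uniq sub_r (enum_uniq _).
case/orP=> /andP[size_r /pairwise_sorted pr].
  apply/existsP; exists i0; apply/existsP; exists (Tuple size_r).
  by rewrite /= uniq_r.
apply/existsP; exists i1; apply/existsP; exists (Tuple size_r).
rewrite /= uniq_r; apply: sub_sorted pr => x y /=.
by rewrite /e negbK => /eqP->.
Qed.

(* p(l_1, ..., l_k) for ls = [:: l_1; ...; l_k]. It is only meaningful for    *)
(* k >= 2; the value is 0 when k < 2.                                         *)
Definition p (ls : seq nat) : nat := ex_minn (path_unavoidable_ex ls).

Lemma pP (ls : seq nat) : 1 < size ls ->
  path_unavoidable ls (p ls)
  /\ forall n, path_unavoidable ls n -> p ls <= n.
Proof.
rewrite /p; case: ex_minnP => n + min_n k_gt1; rewrite k_gt1 => Pn.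
by split=> // m Pm; apply: min_n; rewrite k_gt1.
Qed.

(* Main.v *)
Require Import Defs.
From mathcomp Require Import all_boot zify.

(* Say that colour i has deficiency d_i if a longest path avoiding i misses    *)
(* d_i vertices. Everything reduces to the following: deficiencies at least    *)
(* D_1 >= ... >= D_t can be realised on n vertices if and only if              *)
(*   D_1 + 2 D_2 + ... + 2^(t-1) D_t <= n - 1.                                 *)
(* Necessity: let h be the largest number of edges of one colour, j, at one    *)
(* vertex, u. If uv has another colour i, then at most (n-1-h) + h edges of    *)
(* colour i meet u or v, so in the graph of the other colours the degrees of   *)
(* u and v add up to at least n - 1; by the Bondy-Chvatal argument recolouring *)
(* uv with j lengthens no path avoiding i. Repeating this, all edges at u get  *)
(* colour j. Deleting u then lowers d_j by at most 1, and raises each other    *)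
(* positive d_i by at least 1, as a path avoiding i extends by u and a further *)
(* vertex. Induction on n applies, and the sorted order minimises the sum.     *)
(* Sufficiency: on nested vertex sets of sizes D_(i+1) + 2 D_(i+2) + ..., let  *)
(* the level of a vertex count the sets containing it, and colour each edge    *)
(* with the larger level of its two ends.                                      *)

Set Implicit Arguments.
Unset Strict Implicit.
Unset Printing Implicit Defensive.

(** A colouring on n vertices defeats all paths exactly when each colour i has deficiency at least
    max(0, n + 1 - l_i). The criterion on deficiencies thus becomes [path_unavoidableE]: n is
    unavoidable iff n - 1 is less than the sum of the 2^(i-1) max(0, n + 1 - l_i). Necessity is
    [dsum_deficient], resting on [bondy_chvatal_path] through [dominating_vertex], with the powers
    of 2 explained by [dsum_shift]; sufficiency is [dsum_avoidable], resting on [size_hub_path].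

    The rest is arithmetic. For n < l_t the last term vanishes and the conditions for t and t - 1
    colours agree, which settles the case l_t >= p(l_1, ..., l_(t-1)). In the other case only n >=
    l_t matter; no term is truncated, and with W = l_1 + 2 l_2 + ... + 2^(t-1) l_t the condition
    reads W - 2 < (n + 1)(2^t - 2), whose least solution is the stated quotient. *)

(** * Sums with weights 1, 2, 4, .. *)

Definition dsum (ds : seq nat) : nat := foldr (fun d a => d + 2 * a) 0 ds.

Lemma dsum_cat_nseq0 (ds : seq nat) k : dsum (ds ++ nseq k 0) = dsum ds.
Proof. by elim: ds => [|d ds /= -> //]; elim: k => //= k ->. Qed.

Lemma leq_dsum_drop i j (ds : seq nat) :
  i <= j -> dsum (drop j ds) <= dsum (drop i ds).
Proof.
elim: ds i j => [|d ds IH] [|i] [|j] //= le_ij; last exact: IH.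
by have := IH 0 j (leq0n _); rewrite drop0; lia.
Qed.

Lemma dsum_drop i (ds : seq nat) :
  i < size ds -> dsum (drop i ds) = nth 0 ds i + 2 * dsum (drop i.+1 ds).
Proof. by move=> lt_i; rewrite (drop_nth 0). Qed.

Lemma dsum_cat_le (d : nat) (a b : seq nat) :
  all (fun x => x <= d) a -> dsum (d :: a ++ b) <= dsum (a ++ d :: b).
Proof.
elim: a => //= x a IH /andP[le_xd /IH]; rewrite /=; lia.
Qed.

(** Rearrangement: the weights increase along the list, so moving a largest entry to the front never
    increases the sum. *)
Lemma dsum_sorted_min (ds es : seq nat) :
  sorted geq ds -> perm_eq ds es -> dsum ds <= dsum es.
Proof.
elim: ds es => [|d ds IH] es; first by case: es => // x es _ /perm_size.
move=> sorted_ds /[dup] eq_es /perm_mem/(_ d); rewrite mem_head => /esym d_in.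
case/splitPr: d_in eq_es => a b.
rewrite perm_sym -cat1s perm_catCA /= perm_cons perm_sym => eq_ab.
apply: leq_trans (dsum_cat_le _ _).
  by rewrite /= leq_add2l leq_mul2l /= IH ?(path_sorted sorted_ds).
apply/allP=> x xa.
have geq_trans : transitive geq by move=> y x' z /= ? ?; lia.
have /allP/(_ x) := order_path_min geq_trans sorted_ds.
by apply; rewrite (perm_mem eq_ab) mem_cat xa.
Qed.

(** * Bondy-Chvatal closure for paths *)

(** Without a crossing, each of the [size q] consecutive pairs contributes at most one to the two
    counts together; only the last vertex, as a [P], starts no pair. *)
Lemma crossing_or_count (T : Type) (P Q : pred T) (x : T) (q : seq T) :
  (exists q1 y z q2, [/\ x :: q = q1 ++ [:: y, z & q2], P y & Q z])
  \/ count Q q + count P (x :: q) <= size q + P (last x q).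
Proof.
elim: q x => [|y q IH] x; first by right; rewrite /= addn0.
have [/andP[Px Qy]|notPQ] := boolP (P x && Q y).
  by left; exists [::], x, y, q.
case: (IH y) => [[q1 [y' [z [q2 [-> Py Qz]]]]]|le_q].
  by left; exists (x :: q1), y', z, q2.
by right; move: notPQ le_q => /=; case: (P x); case: (Q y) => //= _; lia.
Qed.

(** With a crossing y, z on the path from u, the new path runs from the far end of that path back to
    z, jumps to u, goes forward to y, jumps to v and follows [b]. *)
Lemma reconnect_paths (T : eqType) (e : rel T) (u v : T) (a b : seq T) :
  symmetric e -> path e u a -> path e v b ->
  (exists q1 y z q2, [/\ u :: a = q1 ++ [:: y, z & q2], e v y & e u z])
    \/ e v (last u a) ->
  exists2 s, perm_eq s ((u :: a) ++ v :: b) & sorted e s.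
Proof.
move=> sym_e path_a path_b [[q1 [y [z [q2 [def_a evy euz]]]]]|evl]; last first.
  by exists ((u :: a) ++ v :: b); rewrite //= cat_path path_a /= sym_e evl.
exists (rev (z :: q2) ++ (rcons q1 y ++ v :: b)).
  by rewrite def_a -[q1 ++ _]cat_rcons -catA perm_catCA !perm_cat2l perm_cat2r
             perm_rev.
have sorted_a : sorted e (q1 ++ [:: y, z & q2]) by rewrite -def_a.
have sorted_z : sorted e (z :: q2).
  move: sorted_a; rewrite -cat_rcons => /cat_sorted2[]//.
have sorted_y : sorted e (rcons q1 y).
  by move: sorted_a; rewrite -cat_rcons => /cat_sorted2[].
have head_y : head u (rcons q1 y) = u by case: (q1) def_a => [|? ?] [<-].
move: sorted_y head_y; case def_q: (rcons q1 y) => [|u' q] /=; first by case: (q1) def_q.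
move=> path_q eq_u; move: path_q def_q; rewrite {}eq_u => path_q def_q.
have last_q : last u q = y by rewrite -[last u q]/(last u (u :: q)) -def_q last_rcons.
rewrite rev_cons cat_rcons.
case def_r: (rev q2) => [|r0 r] /=.
  by rewrite sym_e euz cat_path path_q /= last_q sym_e evy.
have : sorted e (rev (z :: q2)).
  by rewrite rev_sorted (eq_sorted (e' := e)) // => x' y'; rewrite sym_e.
rewrite rev_cons def_r /= rcons_path => /andP[path_r elz].
by rewrite cat_path path_r /= elz sym_e euz cat_path path_q /= last_q sym_e evy.
Qed.

Lemma card_setI_count (T : finType) (A : {set T}) (s : seq T) :
  uniq s -> #|A :&: [set x in s]| = count (mem A) s.
Proof.
move=> uniq_s; rewrite -size_filter -(card_uniqP (filter_uniq _ uniq_s)).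
by apply: eq_card => x; rewrite !inE mem_filter.
Qed.

(** If no reconnection works, the counts of neighbours of u and of v inside [s] add up to at most
    |s| - 2. If moreover u and v have no common neighbour outside [s], at most |X| - |s| are added
    there, in all one less than [degs] demands. *)
Lemma paths_joined_by_edge (T : finType) (e : rel T) (X : {set T}) (u v : T)
    (a b : seq T) :
  symmetric e -> irreflexive e ->
  #|X| <= (#|[set x in X | e u x]| + #|[set x in X | e v x]|).+1 ->
  path e u a -> path e v b -> uniq ((u :: a) ++ v :: b) ->
  {subset (u :: a) ++ v :: b <= X} ->
  exists s, [/\ uniq s, {subset s <= X}, sorted e s
    & size ((u :: a) ++ v :: b) <= size s].
Proof.
move=> sym_e irr_e degs path_a path_b; set s := _ ++ _ => uniq_s sub_s.
have perm_ok r : perm_eq r s -> sorted e r ->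
    exists s', [/\ uniq s', {subset s' <= X}, sorted e s' & size s <= size s'].
  move=> eq_r sorted_r; exists r; split=> //; first by rewrite (perm_uniq eq_r).
    by move=> x; rewrite (perm_mem eq_r); apply: sub_s.
  by rewrite (perm_size eq_r).
case: (crossing_or_count (e v) (e u) u a) => [cross|cnt_a].
  by have [r] := reconnect_paths sym_e path_a path_b (or_introl cross);
    apply: perm_ok.
case: (crossing_or_count (e u) (e v) v b) => [cross|cnt_b].
  have [r eq_r] := reconnect_paths sym_e path_b path_a (or_introl cross).
  by apply: perm_ok; rewrite (perm_trans eq_r) // perm_catC.
have [evl|Nevl] := boolP (e v (last u a)).
  by have [r] := reconnect_paths sym_e path_a path_b (or_intror evl);
    apply: perm_ok.
have [eul|Neul] := boolP (e u (last v b)).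
  have [r eq_r] := reconnect_paths sym_e path_b path_a (or_intror eul).
  by apply: perm_ok; rewrite (perm_trans eq_r) // perm_catC.
set Nu := [set x in X | e u x] in degs; set Nv := [set x in X | e v x] in degs.
pose S := [set x in s].
have cntN w : count (mem [set x in X | e w x]) s = count (e w) s.
  by apply: eq_in_count => x /sub_s xX; rewrite !inE xX.
have size_S : #|S| = size s.
  by rewrite -(card_uniqP uniq_s); apply: eq_card => x; rewrite inE.
(* A common neighbour off both paths can be inserted between u and v. *)
have [w|disj] := pickP [pred w | w \in (Nu :\: S) :&: (Nv :\: S)].
  rewrite [_ w]/= in_setI !in_setD !in_set.
  case/andP=> /and3P[wNs wX euw] /and3P[_ _ evw].
  have eq_s : perm_eq (rev (u :: a) ++ w :: v :: b) (w :: s).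
    by rewrite -[w :: v :: b]cat1s perm_catCA perm_cons perm_cat2r perm_rev.
  exists (rev (u :: a) ++ w :: v :: b); split.
  - by rewrite (perm_uniq eq_s) /= wNs.
  - by move=> x; rewrite (perm_mem eq_s) => /predU1P[->|/sub_s].
  - rewrite rev_cons cat_rcons.
    have : sorted e (rev (u :: a)).
      by rewrite rev_sorted (eq_sorted (e' := e)) // => x' y'; rewrite sym_e.
    rewrite rev_cons; case: (rev a) => [|r0 r] /=.
      by rewrite euw sym_e evw.
    rewrite rcons_path => /andP[path_r elu].
    by rewrite cat_path path_r /= elu euw sym_e evw.
  - by rewrite /s !size_cat size_rev /=; lia.
have out : #|Nu :\: S| + #|Nv :\: S| + size s <= #|X|.
  rewrite -cardsUI (_ : (Nu :\: S) :&: (Nv :\: S) = set0); last first.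
    by apply/setP=> w; rewrite in_set0; exact: disj.
  rewrite cards0 addn0 -size_S -cardsUI.
  rewrite [X in _ + X](_ : _ = 0) ?addn0.
    apply: subset_leq_card; apply/subsetP=> x.
    rewrite !(in_setU, in_setD, in_set) => /orP[/orP[]/and3P[]//|/sub_s //].
  apply/eqP; rewrite cards_eq0; apply/eqP/setP=> x.
  rewrite !(in_setI, in_setU, in_setD, in_set).
  by case: (x \in s); rewrite ?andbF.
have := cardsID S Nu; have := cardsID S Nv.
rewrite !card_setI_count // !cntN /s !count_cat /=.
move: cnt_a cnt_b out; rewrite /s size_cat /= !irr_e (negPf Nevl) (negPf Neul).
lia.
Qed.

Lemma bondy_chvatal_path (T : finType) (e : rel T) (X : {set T}) (u v : T)
    (s : seq T) :
  symmetric e -> irreflexive e ->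
  #|X| <= (#|[set x in X | e u x]| + #|[set x in X | e v x]|).+1 ->
  uniq s -> {subset s <= X} ->
  sorted (fun x y => e x y || ((x, y) \in [:: (u, v); (v, u)])) s ->
  exists s', [/\ uniq s', {subset s' <= X}, sorted e s' & size s <= size s'].
Proof.
move=> sym_e irr_e degs uniq_s sub_s sorted_s.
have [ok|bad] := boolP (sorted e s); first by exists s.
have [a [b [x [y [def_s Nexy]]]]] :
    exists a b x y, s = a ++ [:: x, y & b] /\ ~~ e x y.
  elim: (s) bad => // x [|y q] // IH.
  rewrite [sorted _ _]/= negb_and; have [exy|Nexy _] := boolP (e x y).
    by case/IH=> a [b [x' [y' [-> N]]]]; exists (x :: a), b, x', y'.
  by exists [::], q, x, y.
have uniq_xy : uniq (rcons a x ++ y :: b) by rewrite cat_rcons -def_s.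
set e' := fun x y : T => _ in sorted_s.
have [sorted_a sorted_b e'xy] :
    [/\ sorted e' (rcons a x), sorted e' (y :: b) & e' x y].
  move: sorted_s; rewrite def_s -cat_rcons; case: (a) => [|a0 a'] /=.
    by case/andP.
  by rewrite cat_path last_rcons /= => /and3P[].
have xy : (x, y) = (u, v) \/ (x, y) = (v, u).
  move: e'xy; rewrite /e' (negPf Nexy) orFb !inE.
  by case/orP=> /eqP->; [left|right].
(* Since [s] repeats no vertex, it uses the extra edge uv at most once; a segment missing u or v
   runs inside [e]. *)
have clean r : ~~ ((u \in r) && (v \in r)) -> sorted e' r -> sorted e r.
  move=> Nuv; apply: sub_in_sorted (allss r) => x' y' xr yr.
  case/orP=> //; rewrite !inE => /orP[] /eqP[eqx eqy];
    by rewrite -eqx -eqy xr yr in Nuv.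
have /andP[xNb yNa] : (x \notin y :: b) && (y \notin rcons a x).
  move: uniq_xy; rewrite cat_uniq => /and3P[_ /hasPn Nb _].
  rewrite (Nb y) ?mem_head // andbT; apply/negP => /Nb.
  by rewrite mem_rcons mem_head.
have degs_xy : #|X| <= (#|[set z in X | e x z]| + #|[set z in X | e y z]|).+1.
  by case: xy => -[-> ->] //; rewrite addnC.
have Nxy r : (x \notin r) || (y \notin r) -> ~~ ((u \in r) && (v \in r)).
  by rewrite -negb_and; case: xy => -[-> ->] //; rewrite andbC.
have path_a : path e x (rev a).
  have: sorted e (rcons a x) by apply: clean => //; rewrite Nxy // yNa orbT.
  by rewrite -rev_sorted rev_rcons (eq_sorted (e' := e)) // => ? ?; rewrite sym_e.
have path_b : path e y b by apply: (clean (y :: b)); rewrite // Nxy // xNb.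
have eq_s : perm_eq s ((x :: rev a) ++ y :: b).
  by rewrite def_s -cat_rcons perm_cat2r -rev_rcons perm_sym perm_rev.
have [|z|s' [? ? ? size_s']] :=
    paths_joined_by_edge sym_e irr_e degs_xy path_a path_b.
- by rewrite -(perm_uniq eq_s).
- by rewrite -(perm_mem eq_s); apply: sub_s.
- by exists s'; split; rewrite // (perm_size eq_s).
Qed.

(** * Recolouring until one vertex sees a single colour *)

(** The values of [c] on the diagonal are arbitrary; [x != y] makes the relation irreflexive, as the
    closure argument requires. *)
Definition avoids (T K : eqType) (c : T -> T -> K) (i : K) : rel T :=
  fun x y => (x != y) && (c x y != i).

Definition deficient (T : finType) (K : eqType) (c : T -> T -> K)
    (X : {set T}) (i : K) (d : nat) :=
  forall s, uniq s -> {subset s <= X} -> sorted (avoids c i) s ->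
    size s + d <= #|X|.

Definition cdeg (T : finType) (K : eqType) (c : T -> T -> K) (X : {set T})
    (u : T) (i : K) := #|[set x in X | (x != u) && (c u x == i)]|.

Section Recolour.
Variables (T K : finType) (X : {set T}).
Implicit Types (c : T -> T -> K) (u v x y : T) (i j : K).

Lemma avoids_sym c i : commutative c -> symmetric (avoids c i).
Proof. by move=> cC x y; rewrite /avoids eq_sym cC. Qed.

Lemma avoids_irr c i : irreflexive (avoids c i).
Proof. by move=> x; rewrite /avoids eqxx. Qed.

Lemma cdeg_avoids c u i : u \in X ->
  cdeg c X u i + #|[set x in X | avoids c i u x]| = #|X|.-1.
Proof.
move=> uX; rewrite (cardsD1 u X) uX add1n /=.
rewrite -(cardsID [set x | c u x == i] (X :\ u)) /cdeg; congr (_ + _).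
  by apply: eq_card => x; rewrite !inE; case: (x \in X); rewrite ?andbF ?andbT.
apply: eq_card => x; rewrite !inE /avoids eq_sym.
by case: (x \in X); rewrite ?andbF ?andbT //= andbC.
Qed.

Lemma leq_cdegD c u i j : u \in X -> i != j ->
  cdeg c X u i + cdeg c X u j <= #|X|.-1.
Proof.
move=> uX neq_ij; rewrite -(cdeg_avoids c i uX) leq_add2l.
apply: subset_leq_card; apply/subsetP=> x; rewrite !inE /avoids eq_sym.
by case/and3P=> -> -> /eqP->; rewrite eq_sym neq_ij.
Qed.

Lemma recolour_edge c u v j :
  commutative c -> u \in X -> v \in X -> v != u -> c u v != j ->
  (forall x i, x \in X -> cdeg c X x i <= cdeg c X u j) ->
  exists c', [/\ commutative c', cdeg c X u j < cdeg c' X u j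
    & forall i d, deficient c X i d -> deficient c' X i d].
Proof.
move=> cC uX vX neq_vu cuv_j max_uj.
pose c' x y := if (x, y) \in [:: (u, v); (v, u)] then j else c x y.
exists c'; split.
- move=> x y; rewrite /c' cC !inE !xpair_eqE orbC.
  by rewrite [(x == v) && _]andbC [(x == u) && _]andbC.
- apply: proper_card; apply/properP; split; last first.
    by exists v; rewrite !inE vX neq_vu /c' ?mem_head ?eqxx // (negPf cuv_j).
  apply/subsetP=> x; rewrite !inE => /and3P[-> -> /eqP cux].
  by rewrite /c' cux; case: ifP; rewrite eqxx.
- move=> i d def_i s uniq_s sub_s sorted_s.
  have [s' [uniq_s' sub_s' sorted_s' size_s']] : exists s',
      [/\ uniq s', {subset s' <= X}, sorted (avoids c i) s' & size s <= size s'].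
    (* Only for the old colour of uv does the avoiding graph gain an edge. *)
    have [eq_i|neq_i] := eqVneq (c u v) i; last first.
      exists s; split=> //; apply: sub_sorted sorted_s => x y.
      rewrite /avoids /c' => /andP[-> /=]; case: ifP => //.
      by rewrite !inE => /orP[] /eqP[-> ->] // _; rewrite cC.
    apply: (@bondy_chvatal_path _ (avoids c i) X u v) uniq_s sub_s _.
    + exact: avoids_sym.
    + exact: avoids_irr.
    + have := cdeg_avoids c i uX; have := cdeg_avoids c i vX.
      have neq_ij : i != j by rewrite -eq_i.
      have := leq_cdegD c uX neq_ij; have := max_uj v i vX; lia.
    + apply: sub_sorted sorted_s => x y.
      by rewrite /avoids /c'; case: ifP => _; rewrite ?orbT // orbF.
  by apply: leq_trans (def_i s' _ _ _); rewrite ?leq_add2r.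
Qed.

Lemma dominating_vertex c u0 j0 :
  commutative c -> u0 \in X ->
  exists c' u j, [/\ commutative c', u \in X,
    forall v, v \in X -> v != u -> c' u v = j
    & forall i d, deficient c X i d -> deficient c' X i d].
Proof.
move=> cC u0X.
(* Each recolouring raises the largest colour degree, which stays below |X|; [k] bounds the room
   left. *)
have [k] : exists k, #|X| <= cdeg c X u0 j0 + k by exists #|X|; rewrite leq_addl.
elim: k => [|k IH] in c u0 j0 cC u0X *.
  have := cdeg_avoids c j0 u0X; have : 0 < #|X| by apply/card_gt0P; exists u0.
  lia.
move=> le_k.
have := @arg_maxnP _ (u0, j0) (fun w => w.1 \in X) (fun w => cdeg c X w.1 w.2) u0X.
case=> -[u j] /= uX max_uj.
have [v /and3P[vX neq_vu cuv_j]|mono] :=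
    pickP [pred v | [&& v \in X, v != u & c u v != j]]; last first.
  exists c, u, j; split=> // v vX neq_vu; apply/eqP.
  by have := mono v; rewrite /= vX neq_vu /= => /negbFE.
have [|c' [c'C lt_deg def_c']] := recolour_edge cC uX vX neq_vu cuv_j.
  by move=> x i xX; apply: (max_uj (x, i)).
have [|c'' [u' [j' [? ? ? def_c'']]]] := IH c' u j c'C uX.
  by have := max_uj (u0, j0) u0X; rewrite /=; lia.
by exists c'', u', j'; split=> // i d /def_c'; apply: def_c''.
Qed.

End Recolour.

(** * Necessity, by deleting the dominating vertex *)

Lemma deficientD1 (T K : finType) (c : T -> T -> K) (X : {set T}) (u : T)
    (i j : K) (d : nat) :
  commutative c -> u \in X -> (forall v, v \in X -> v != u -> c u v = j) ->
  0 < d -> deficient c X i d ->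
  deficient c (X :\ u) i (if i == j then d.-1 else d.+1).
Proof.
move=> cC uX dom d_gt0 def_i s uniq_s sub_s sorted_s.
have sub_sX : {subset s <= X} by move=> x /sub_s /setD1P[].
have uNs : u \notin s by apply/negP => /sub_s; rewrite !inE eqxx.
have cardX := cardsD1 u X; rewrite uX in cardX.
case: eqVneq => [_|neq_ij].
  by have := def_i s uniq_s sub_sX sorted_s; lia.
have joined x : x \in X -> x != u -> avoids c i x u.
  by move=> xX xu; rewrite /avoids xu cC dom // eq_sym.
have sorted_su : sorted (avoids c i) (rcons s u).
  case: (s) sub_s sorted_s => // x s' sub_s; rewrite /= rcons_path => ->.
  have /sub_s/setD1P[? ?] := mem_last x s'; exact: joined.
have sub_su : {subset rcons s u <= X}.
  by move=> x; rewrite mem_rcons inE => /predU1P[->|/sub_sX].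
have uniq_su : uniq (rcons s u) by rewrite rcons_uniq uNs.
have [x /andP[xX xNs]|full] := pickP [pred x | (x \in X :\ u) && (x \notin s)].
  case/setD1P: xX => xu xX.
  suff : size (rcons (rcons s u) x) + d <= #|X| by rewrite !size_rcons; lia.
  apply: def_i.
  - by rewrite rcons_uniq uniq_su mem_rcons inE negb_or xu xNs.
  - by move=> y; rewrite mem_rcons inE => /predU1P[->|/sub_su].
  - move: sorted_su; case def_su: (rcons s u) => [|y s'] // path_s'.
    rewrite /= rcons_path (path_s' : path _ _ _) -[last y s']/(last y (y :: s')).
    by rewrite -def_su last_rcons avoids_sym // joined.
(* If [s] exhausts X without u, then appending u covers X, against [0 < d]. *)
have := def_i _ uniq_su sub_su sorted_su; rewrite size_rcons.
have : #|X :\ u| <= size s.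
  rewrite -(card_uniqP uniq_s); apply: subset_leq_card; apply/subsetP => x xX.
  by have /negbT := full x; rewrite /= xX negbK.
lia.
Qed.

Lemma leq_dsum (K : eqType) (D D' : K -> nat) (L : seq K) :
  {in L, forall i, D i <= D' i} -> dsum (map D L) <= dsum (map D' L).
Proof.
elim: L => //= i L IH le_D; apply: leq_add; first exact/le_D/mem_head.
by rewrite leq_mul2l IH // => k kL; apply: le_D; rewrite inE kL orbT.
Qed.

(** This is where the weights come from: if j has weight 2^r, the gain 2^r is offset by the losses 1
    + 2 + ... + 2^(r-1) at the earlier entries, leaving a net gain of at most 1; later entries only
    help. *)
Lemma dsum_shift (K : eqType) (D D' : K -> nat) (j : K) (L : seq K) :
  uniq L -> {in L, forall i, D i <= if i == j then (D' i).+1 else (D' i).-1} ->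
  {in L, forall i, 0 < D i} ->
  dsum (map D L) <= (dsum (map D' L)).+1.
Proof.
elim: L => //= i L IH /andP[iNL uniq_L] le_D D_gt0.
have sub_L k : k \in L -> k \in i :: L by rewrite inE orbC => ->.
have {}IH : dsum (map D L) <= (dsum (map D' L)).+1.
  by apply: IH => // k /sub_L; [apply: le_D | apply: D_gt0].
have := le_D i (mem_head _ _); have := D_gt0 i (mem_head _ _).
case: eqVneq => [eq_ij|_]; last by lia.
have : dsum (map D L) <= dsum (map D' L); last by lia.
apply: leq_dsum => k kL; have := le_D k (sub_L k kL); have := D_gt0 k (sub_L k kL).
case: eqVneq => [eq_kj|_]; last by lia.
by rewrite eq_ij -eq_kj kL in iNL.
Qed.

(** The order of the colours comes out of the induction; [dsum_sorted_min] later compares it with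
    the sorted one. *)
Lemma dsum_deficient (T K : finType) (c : T -> T -> K) (X : {set T})
    (L : seq K) (D : K -> nat) :
  commutative c -> uniq L -> {in L, forall i, deficient c X i (D i)} ->
  exists2 L', perm_eq L' L & dsum (map D L') <= #|X|.-1.
Proof.
have [n] := ubnP #|X|; elim: n => // n IH in c X L D *.
move=> lt_n cC uniq_L def_L.
(* Colours of deficiency 0 go last, where they add nothing; the others meet the positivity
   hypotheses of [deficientD1] and [dsum_shift]. *)
pose L0 := [seq i <- L | 0 < D i].
suff [L' eq_L' le_L'] : exists2 L', perm_eq L' L0 & dsum (map D L') <= #|X|.-1.
  exists (L' ++ [seq i <- L | ~~ (0 < D i)]).
    by rewrite perm_sym -(perm_filterC (fun i => 0 < D i)) perm_cat2r perm_sym.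
  rewrite map_cat [X in _ ++ X](_ : _ = nseq (count (fun i => ~~ (0 < D i)) L) 0).
    by rewrite dsum_cat_nseq0.
  by elim: (L) => //= i L1 IH1; case: posnP => //= ->; rewrite IH1.
have [->|] := eqVneq L0 [::]; first by exists [::].
case def_L0: L0 => [|i0 L1] // _; rewrite -def_L0.
have L0P i : i \in L0 -> 0 < D i /\ deficient c X i (D i).
  by rewrite mem_filter => /andP[? /def_L].
have [D0_gt0 def_i0] : 0 < D i0 /\ deficient c X i0 (D i0).
  by apply: L0P; rewrite def_L0 mem_head.
have X_gt0 : 0 < #|X|.
  by apply: leq_trans D0_gt0 _; apply: (def_i0 [::]).
have [u0 u0X] := card_gt0P X_gt0.
have [c' [u [j [c'C uX dom def_c']]]] := dominating_vertex i0 cC u0X.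
(* A one-vertex path already misses a vertex. Hence [#|X|.-1] really drops by 1 when u is
   deleted. *)
have X_gt1 : 1 < #|X|.
  have := def_i0 [:: u0] isT; rewrite /= add1n => /(_ _ isT) H.
  by apply: leq_ltn_trans D0_gt0 (H _) => x; rewrite inE => /eqP->.
have cardX := cardsD1 u X; rewrite uX in cardX.
pose D' i := if i == j then (D i).-1 else (D i).+1.
have [||i iL0|L' eq_L' le_L'] := IH c' (X :\ u) L0 D' _ c'C.
- by lia.
- exact: filter_uniq.
- have [D_gt0 /def_c' def_i] := L0P i iL0.
  exact: deficientD1.
exists L' => //.
suff le_D : dsum (map D L') <= (dsum (map D' L')).+1.
  apply: leq_trans le_D _; move: X_gt1 le_L'; rewrite cardX add1n.
  by case: #|X :\ u|.
apply: (@dsum_shift _ D D' j).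
- by rewrite (perm_uniq eq_L') filter_uniq.
- by move=> i _; rewrite /D'; case: eqP => //; lia.
- by move=> i; rewrite (perm_mem eq_L') => /L0P[].
Qed.

Lemma avoiding_path (n k : nat) (c : edge_colouring n k) (i : 'I_k) (m : nat)
    (s : seq 'I_n) :
  uniq s -> sorted (fun x y => c [set x; y] != i) s -> m <= size s ->
  has_path_avoiding c i m.
Proof.
move=> uniq_s sorted_s le_m; apply/existsP.
have size_s : size (take m s) == m by rewrite size_takel.
by exists (Tuple size_s); rewrite /= take_uniq // take_sorted.
Qed.

Lemma dsum_unavoidable (ls : seq nat) (n : nat) :
  0 < size ls -> sorted leq ls -> 0 < nth 0 ls 0 ->
  n.-1 < dsum [seq n.+1 - l | l <- ls] -> path_unavoidable ls n.
Proof.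
move=> ls_gt0 sorted_ls l0_gt0; apply: contraLR => /forallPn[c].
rewrite negb_exists => /forallP avoid; rewrite -leqNgt.
pose cc x y := c [set x; y].
pose D (i : 'I_(size ls)) := n.+1 - nth 0 ls i.
have [|i _ s uniq_s _ sorted_s|L eq_L le_L] :=
    @dsum_deficient _ _ cc [set: 'I_n] (enum 'I_(size ls)) D _ (enum_uniq _).
- by move=> x y; rewrite /cc setUC.
- have size_n : size s <= n.
    by rewrite -(card_uniqP uniq_s) -[leqRHS]card_ord max_card.
  rewrite cardsT card_ord /D; have [lt_s|le_s] := ltnP (size s) (nth 0 ls i).
    lia.
  have/negP[] := avoid i; apply: avoiding_path le_s => //.
  by apply: sub_sorted sorted_s => x y /andP[].
rewrite cardsT card_ord in le_L; apply: leq_trans le_L.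
(* Increasing lengths give decreasing deficiencies. *)
apply: dsum_sorted_min.
  rewrite sorted_map; apply: sub_sorted sorted_ls => x y /=; lia.
rewrite perm_sym (perm_trans (perm_map _ eq_L)) //.
suff -> : [seq D i | i <- enum 'I_(size ls)] = [seq n.+1 - l | l <- ls] by [].
rewrite -[in RHS](mkseq_nth 0 ls) /mkseq -val_enum_ord -!map_comp.
exact: eq_map.
Qed.

(** * Sufficiency: the colouring by levels *)

(** On the path, the predecessor of each vertex of [A] lies in [S]. *)
Lemma count_isolated (T : Type) (e : rel T) (S A : pred T) (x : T) (s : seq T) :
  (forall y z, e y z -> A z -> S y) -> path e x s ->
  count A s <= count S (x :: s).
Proof.
move=> eAS; elim: s x => //= y s IH x /andP[exy /IH].
have := eAS x y exy; rewrite /=; case: (A y) => [->//|_]; last lia.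
Qed.

Lemma count_lt_ord (n m : nat) (s : seq 'I_n) :
  uniq s -> count (fun x : 'I_n => x < m) s <= m.
Proof.
move=> uniq_s; rewrite -[leqRHS](size_iota 0) -size_filter -(size_map val).
apply: uniq_leq_size; first by rewrite (map_inj_uniq val_inj) filter_uniq.
by move=> _ /mapP[x + ->]; rewrite mem_filter mem_iota => /andP[].
Qed.

Lemma count_geq_ord (n m : nat) (s : seq 'I_n) :
  uniq s -> count (fun x : 'I_n => m <= x) s <= n - m.
Proof.
move=> uniq_s; rewrite -[leqRHS](size_iota m) -size_filter -(size_map val).
apply: uniq_leq_size; first by rewrite (map_inj_uniq val_inj) filter_uniq.
move=> _ /mapP[x + ->]; rewrite mem_filter mem_iota => /andP[/= le_m _].
have := ltn_ord x; lia.
Qed.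

(* Off the hub S the vertices of A are isolated. Hence, away from a vertex     *)
(* outside S and A, a path leaves every vertex of A through a vertex of S.    *)
Lemma size_hub_path (T : eqType) (e : rel T) (S A : pred T) (s : seq T) :
  symmetric e -> (forall y z, e y z -> A z -> S y) -> sorted e s ->
  size s <= 2 * count S s + maxn 1 (count (predC (predU S A)) s).
Proof.
move=> sym_e eAS sorted_s.
have size_le r : size r <= count S r + count A r + count (predC (predU S A)) r.
  elim: r => //= x r; rewrite /predU /=; case: (S x); case: (A x) => /=; lia.
(* On a path inside the union of S and A, only the first vertex can be in A without a predecessor in
   S; this costs the 1 in [maxn]. *)
have [all_SA|] := boolP (all (predU S A) s).
  have := size_le s; rewrite (eqP (_ : count (predC _) s == 0)); last first.
    by rewrite -leqn0 leqNgt -has_count has_predC all_SA.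
  case: s sorted_s {all_SA} => // x s path_s.
  by have := count_isolated eAS path_s; rewrite /=; lia.
rewrite -has_predC => /hasP[x xs /norP[NSx NAx]].
case/splitPr: xs sorted_s => a b sorted_s.
have path_b : path e x b by move: sorted_s => /cat_sorted2[].
have path_a : path e x (rev a).
  have : sorted e (rcons a x) by move: sorted_s; rewrite -cat_rcons => /cat_sorted2[].
  by rewrite -rev_sorted rev_rcons (eq_sorted (e' := e)) // => ? ?; rewrite sym_e.
have := count_isolated eAS path_a; have := count_isolated eAS path_b.
rewrite /= !count_rev (negPf NSx) /=.
have := size_le (a ++ x :: b); rewrite !count_cat /= (negPf NSx) (negPf NAx) /=.
lia.
Qed.

Lemma dsum_avoidable (ls : seq nat) (n : nat) :
  0 < size ls -> all (leq 2) ls ->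
  path_unavoidable ls n -> n.-1 < dsum [seq n.+1 - l | l <- ls].
Proof.
move=> ls_gt0 ls_ge2; apply: contraTT; rewrite -leqNgt => le_n.
set ds := map _ ls in le_n.
have size_ds : size ds = size ls by rewrite size_map.
pose thr i := dsum (drop i ds).
(* The nested sets are initial segments: the vertices of level above i are those below
   [thr i.+1]. *)
pose lev x := find (fun i => thr i.+1 <= x) (iota 0 (size ls)).
have thr_anti i j : i <= j -> thr j <= thr i by exact: leq_dsum_drop.
have lev_lt x : lev x < size ls.
  rewrite -[leqRHS](size_iota 0) -has_find; apply/hasP; exists (size ls).-1.
    by rewrite mem_iota /=; lia.
  by rewrite prednK // /thr drop_oversize // size_ds.
have thr_lev x : thr (lev x).+1 <= x.
  have has_lev : has (fun i => thr i.+1 <= x) (iota 0 (size ls)).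
    by rewrite has_find size_iota; apply: lev_lt.
  by have := nth_find 0 has_lev; rewrite -/(lev x) nth_iota.
have lev_thr x i : i < lev x -> x < thr i.+1.
  move=> lt_i; have := before_find 0 lt_i.
  by rewrite nth_iota ?add0n ?(ltn_trans lt_i) // => /negbT; rewrite -ltnNge.
have max_lt (A : {set 'I_n}) : \max_(x in A) lev x < size ls.
  by rewrite -[ltnRHS]prednK // ltnS; apply/bigmax_leqP=> x _; rewrite -ltnS prednK.
pose c : edge_colouring n (size ls) := [ffun A => Ordinal (max_lt A)].
apply/forallPn; exists c; rewrite negb_exists; apply/forallP => i.
apply/existsPn => -[s /= /eqP size_s]; apply/negP => /andP[uniq_s sorted_s].
have l_ge2 : 2 <= nth 0 ls i by apply: (allP ls_ge2); rewrite mem_nth.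
pose e (x y : 'I_n) := (x != y) && (maxn (lev x) (lev y) != i).
have sym_e : symmetric e by move=> x y; rewrite /e eq_sym maxnC.
have sorted_e : sorted e s.
  apply: (sub_sorted (e := [rel x y | (x != y) && (c [set x; y] != i)])).
    move=> x y /= /andP[xy]; rewrite /e xy ffunE -val_eqE /=.
    by rewrite big_setU1 ?inE //= big_set1.
  by rewrite sorted_relI sorted_s andbT pairwise_sorted // -uniq_pairwise.
have eAS (y z : 'I_n) : e y z -> lev z == i -> i < lev y.
  by rewrite /e => /andP[_ /eqP neq] /eqP eq_z; move: neq; rewrite eq_z; lia.
(* The hub consists of the levels above i, the isolated vertices are those of level i, and the rest
   are the levels below i. For n > 0, [thr i <= n.-1] makes the [maxn] equal to [n - thr i], and the
   bound becomes n - d_i, less than l_i. *)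
have size_le : size s <= 2 * thr i.+1 + maxn 1 (n - thr i).
  apply: leq_trans (size_hub_path sym_e eAS sorted_e) _; apply: leq_add.
    rewrite leq_mul2l; apply: leq_trans (count_lt_ord _ uniq_s).
    by apply: sub_count => x; apply: lev_thr.
  rewrite geq_max leq_maxl; apply: leq_trans (leq_maxr _ _).
  apply: leq_trans (count_geq_ord _ uniq_s); apply: sub_count => x /= lt_i.
  by apply: leq_trans (thr_lev x); apply: thr_anti; lia.
have thr_i : thr i = n.+1 - nth 0 ls i + 2 * thr i.+1.
  by rewrite /thr dsum_drop ?size_ds // (nth_map 0).
have : thr i <= n.-1.
  by apply: leq_trans le_n; rewrite -[ds in leqRHS]drop0; apply: (thr_anti 0).
have : size s <= n by rewrite -(card_uniqP uniq_s) -[leqRHS]card_ord max_card.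
rewrite size_s in size_le *; lia.
Qed.

(** * From the criterion to the formula *)

Lemma path_unavoidableE (ls : seq nat) (n : nat) :
  0 < size ls -> sorted leq ls -> all (leq 2) ls ->
  path_unavoidable ls n = (n.-1 < dsum [seq n.+1 - l | l <- ls]).
Proof.
move=> ls_gt0 sorted_ls ls_ge2; apply/idP/idP; first exact: dsum_avoidable.
by apply: dsum_unavoidable => //; apply/ltnW/(allP ls_ge2)/mem_nth.
Qed.

Lemma dsum_rcons (ds : seq nat) (d : nat) :
  dsum (rcons ds d) = dsum ds + 2 ^ size ds * d.
Proof. by elim: ds => [|x ds /= ->] /=; rewrite ?expnS; lia. Qed.

Lemma iota_rcons (m n : nat) : iota m n.+1 = rcons (iota m n) (m + n).
Proof. by rewrite -addn1 iotaD cats1. Qed.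

Lemma dsum_iota (f : nat -> nat) (t : nat) :
  dsum [seq f i | i <- iota 1 t] = \sum_(1 <= i < t.+1) 2 ^ i.-1 * f i.
Proof.
elim: t => [|t IH]; first by rewrite big_geq.
rewrite big_nat_recr // -IH iota_rcons map_rcons dsum_rcons add1n.
by rewrite size_map size_iota.
Qed.

(** The weights add up to 2^k - 1 for k entries; the extra [m] on the left avoids the
    subtraction. *)
Lemma dsum_complement (ls : seq nat) (m : nat) :
  all (fun l => l <= m) ls ->
  dsum [seq m - l | l <- ls] + dsum ls + m = 2 ^ size ls * m.
Proof.
elim: ls => [|l ls IH] /=; first by rewrite mul1n.
by case/andP=> le_lm /IH; rewrite expnS; lia.
Qed.

Theorem theorem4 (t : nat) (l : nat -> nat)
    (ht : 3 <= t)
    (hl1 : 2 <= l 1)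
    (hmono : forall i : nat, 1 <= i < t -> l i <= l i.+1) :
  (l t < p [seq l i | i <- iota 1 t.-1] ->
     p [seq l i | i <- iota 1 t]
     = ((\sum_(1 <= i < t.+1) 2 ^ i.-1 * l i) - 2) %/ (2 ^ t - 2))
  /\ (p [seq l i | i <- iota 1 t.-1] <= l t ->
     p [seq l i | i <- iota 1 t] = p [seq l i | i <- iota 1 t.-1]).
Proof.
have l_mono i j : 1 <= i -> i <= j <= t -> l i <= l j.
  move=> i_gt0 /andP[]; elim: j => [|j IH]; first lia.
  rewrite leq_eqVlt => /predU1P[->//|le_ij lt_jt].
  by apply: leq_trans (IH le_ij (ltnW lt_jt)) (hmono j _); lia.
have l_sorted k : k <= t -> sorted leq [seq l i | i <- iota 1 k].
  move=> le_kt; rewrite sorted_map.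
  apply: (sub_in_sorted (P := [pred i | 1 <= i <= k])) (iota_sorted 1 k).
    by move=> i j /= /andP[? ?] /andP[? ?] ?; apply: l_mono => //; lia.
  by apply/allP=> i; rewrite mem_iota inE add1n ltnS.
have l_ge2 k : k <= t -> all (leq 2) [seq l i | i <- iota 1 k].
  move=> le_kt; rewrite all_map; apply/allP=> i; rewrite mem_iota => /= ik.
  by apply: leq_trans hl1 _; apply: l_mono => //; lia.
(* From here on [t] is one less than in the statement, so that [ls] has [t] entries. *)
case: t => // t in ht hmono l_mono l_sorted l_ge2 *; rewrite [_.+1.-1]/=.
rewrite -dsum_iota.
have -> : [seq l i | i <- iota 1 t.+1] = rcons [seq l i | i <- iota 1 t] (l t.+1).
  by rewrite iota_rcons map_rcons add1n.
set ls := [seq l i | i <- iota 1 t]; set lt := l t.+1.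
have size_ls : size ls = t by rewrite size_map size_iota.
have lt_ge2 : 2 <= lt by apply: leq_trans hl1 (l_mono _ _ _ _); lia.
have le_lt : all (fun x => x <= lt) ls.
  rewrite all_map; apply/allP=> i; rewrite mem_iota => /= ik; apply: l_mono; lia.
have unavE n : path_unavoidable ls n = (n.-1 < dsum [seq n.+1 - x | x <- ls]).
  by apply: path_unavoidableE; rewrite ?size_ls ?l_sorted ?l_ge2 //; lia.
have unavE' n : path_unavoidable (rcons ls lt) n =
    (n.-1 < dsum [seq n.+1 - x | x <- ls] + 2 ^ t * (n.+1 - lt)).
  have def_ls' : rcons ls lt = [seq l i | i <- iota 1 t.+1].
    by rewrite iota_rcons map_rcons add1n.
  rewrite path_unavoidableE ?size_rcons //; last 2 first.
  - by rewrite def_ls' l_sorted.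
  - by rewrite def_ls' l_ge2.
  by rewrite map_rcons dsum_rcons size_map size_ls.
have [unav_q min_q] : path_unavoidable ls (p ls)
    /\ forall n, path_unavoidable ls n -> p ls <= n.
  by apply: pP; rewrite size_ls; lia.
have [unav_m min_m] : path_unavoidable (rcons ls lt) (p (rcons ls lt))
    /\ forall n, path_unavoidable (rcons ls lt) n -> p (rcons ls lt) <= n.
  by apply: pP; rewrite size_rcons size_ls; lia.
set q := p ls in unav_q min_q *; set m := p (rcons ls lt) in unav_m min_m *.
have q_le_m : m < lt -> q <= m.
  move=> lt_m; apply: min_q; move: unav_m; rewrite unavE' unavE.
  by rewrite (_ : m.+1 - lt = 0) ?muln0 ?addn0 //; lia.
have m_le_q : m <= q.
  by apply: min_m; move: unav_q; rewrite unavE unavE' => /leq_trans; apply; apply: leq_addr.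
split=> [lt_q|le_q]; last first.
  by apply/eqP; rewrite eqn_leq m_le_q leqNgt; apply/negP => ?; lia.
rewrite dsum_rcons size_ls expnS.
set B := 2 ^ t; set S := dsum ls.
have B_ge4 : 4 <= B by rewrite -[4]/(2 ^ 2) leq_exp2l.
have compl n : lt <= n -> dsum [seq n - x | x <- ls] + S + n = B * n.
  move=> le_n; rewrite dsum_complement ?size_ls //.
  by apply: sub_all le_lt => x le_x; apply: leq_trans le_n.
(* The criterion fails at q - 1 >= lt, where nothing is truncated: (B - 1) q - S <= q - 2. This will
   give [lt <= F]. *)
have S_ge : (B - 2) * lt + 2 <= S.
  have : ~~ path_unavoidable ls q.-1.
    by apply/negP => /min_q; lia.
  rewrite unavE -leqNgt prednK; last lia.
  have := compl q (ltnW lt_q).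
  have : (B - 2) * lt <= (B - 2) * q.-1.
    by rewrite leq_mul2l -ltnS prednK ?lt_q ?orbT //; lia.
  have : (B - 2) * q.-1 + B + 2 * q = B * q + 2 by nia.
  lia.
(* The left side is the criterion for t + 1 colours, as n > 0; its right side says that n is at
   least the quotient [F] below. *)
have lt_F n : lt <= n -> (n <= dsum [seq n.+1 - x | x <- ls] + B * (n.+1 - lt)) =
    (S + B * lt - 2 < n.+1 * (2 * B - 2)).
  move=> le_n; have := compl n.+1 (leqW le_n).
  have le_lt_n : B * lt <= B * n.+1 by rewrite leq_mul2l leqW ?orbT.
  have Blt_ge2 : 2 <= B * lt by rewrite (leq_trans lt_ge2) // leq_pmull //; lia.
  rewrite !mulnBr mulnCA [n.+1 * B]mulnC => eq_n; apply/idP/idP; lia.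
set F := _ %/ _.
have F_ge : lt <= F.
  rewrite leq_divRL; last lia.
  by move: S_ge; rewrite mulnBl mulnBr mulnCA [lt * B]mulnC; lia.
apply/eqP; rewrite eqn_leq; apply/andP; split.
  apply: min_m; rewrite unavE' prednK; last lia.
  rewrite lt_F // /F -ltn_divLR //; lia.
have le_m : lt <= m by rewrite leqNgt; apply/negP => /[dup] /q_le_m; lia.
rewrite -ltnS ltn_divLR; last lia.
rewrite -lt_F //; move: unav_m; rewrite unavE' prednK //; lia.
Qed.
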